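(* Let $a\ge 2$, $c>0$, $d$ be integers with $d<ca$ and $\gcd(d,a)=\gcd(d,c)=1$, let $n\ge 1$, and let $\mathbf s_j=ca^{n+j}-d$ for $j\in\mathbb N$ and $S_n=\langle\{\mathbf s_j:j\in\mathbb N\}\rangle$. Assume that for some integer $m>0$ it holds that $\mathbf s_m\in\langle\{\mathbf s_j:0\le j<m\}\rangle$ but $\mathbf s_{m-1}\notin\langle\{\mathbf s_j:0\le j<m-1\}\rangle$. Then $\{\mathbf s_j:0\le j<m\}$ is the minimal generating set of $S_n$. In particular, $m=e(S_n)$.
   Context: $\mathbb N=\{0,1,2,\ldots\}$. For $A\subseteq\mathbb N$, $\langle A\rangle$ is the submonoid of $(\mathbb N,+)$ generated by $A$ (so $\langle\emptyset\rangle=\{0\}$). For a nontrivial submonoid $M$ of $\mathbb N$, the minimal generating set of $M$ is the unique generating set contained in every generating set of $M$ (its elements are the nonzero elements of $M$ that are not sums of two nonzero elements of $M$; it is finite), and $e(M)$ is its cardinality. *)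

(* Defs.v *)
From HB Require Import structures.
From mathcomp Require Import all_boot all_order all_algebra finmap.
From mathcomp Require Import boolp classical_sets functions cardinality.

Set Implicit Arguments.
Unset Strict Implicit.
Unset Printing Implicit Defensive.

Import Order.TTheory GRing.Theory Num.Theory.
Local Open Scope classical_set_scope.
Local Open Scope ring_scope.

Definition submonoid (M : set nat) : Prop :=
  M 0%N /\ forall x y : nat, M x -> M y -> M (x + y)%N.

Definition gen (A : set nat) : set nat := smallest submonoid A.

Definition is_min_gen_set (A M : set nat) : Prop :=
  gen A = M /\ forall B : set nat, gen B = M -> A `<=` B.

Lemma is_min_gen_set_uniq (A B M : set nat) :
  is_min_gen_set A M -> is_min_gen_set B M -> A = B.
Proof.
by move=> [gA mA] [gB mB]; apply/seteqP; split; [exact: mA | exact: mB].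
Qed.

(* Every submonoid of nat has a (finite) minimal generating set, so the
   default value set0 is never used when M is a submonoid. *)
Definition min_gen_set (M : set nat) : set nat :=
  xget set0 [set A | is_min_gen_set A M].

Definition embdim (M : set nat) : nat := #|` fset_set (min_gen_set M)|%fset.

(* The absolute value only serves to land in nat, cf. sE. *)
Definition s (a c d : int) (n j : nat) : nat := absz (c * a ^+ (n + j) - d)%R.

Lemma sE (a c d : int) (n j : nat) :
  2 <= a -> 0 < c -> d < c * a -> (1 <= n)%N ->
  (s a c d n j)%:Z = c * a ^+ (n + j) - d.
Proof.
move=> a2 c0 dca n1; rewrite /s gez0_abs // subr_ge0.
apply: (le_trans (ltW dca)); rewrite ler_pM2l //.
rewrite -[leLHS]expr1 ler_weXn2l //; first by exact: le_trans a2.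
by rewrite (leq_trans n1) ?leq_addr.
Qed.

Definition smonoid (a c d : int) (n : nat) : set nat := gen (range (s a c d n)).

(* Main.v *)
(** The recursion s_(j+1) = a s_j + (a-1) d shows that s_k = s_i + r implies
    s_(k+1) = s_(i+1) + a r.  Hence a relation writing s_k in terms of its
    predecessors propagates to s_(k+1): everything from s_m on is redundant
    and, conversely, no s_j with j < m is generated by its predecessors.  As
    the sequence is increasing, such an s_j is not a sum of two nonzero
    elements of S_n. *)
Require Import Defs.
From mathcomp Require Import all_boot all_order all_algebra finmap.
From mathcomp Require Import classical_sets functions cardinality.
From mathcomp Require Import zify ring.

Import Order.TTheory GRing.Theory Num.Theory.
Local Open Scope classical_set_scope.
Local Open Scope ring_scope.

Lemma gen_submonoid (A : set nat) : submonoid (gen A).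
Proof.
split=> [B [[B0 _] _] //|x y Ax Ay B AB].
by case: (AB) => -[_ BD] _; apply: BD; [exact: Ax | exact: Ay].
Qed.

Lemma gen_min (A M : set nat) : submonoid M -> A `<=` M -> gen A `<=` M.
Proof. by move=> subM AM x; apply. Qed.

Lemma sub_gen (A : set nat) : A `<=` gen A.
Proof. by move=> x Ax B [_]; apply. Qed.

Lemma gen_mull (A : set nat) (k x : nat) : gen A x -> gen A (k * x)%N.
Proof.
move=> Ax; have [A0 AD] := gen_submonoid A.
by elim: k => [|k IH]; rewrite ?mul0n ?mulSn //; exact: AD.
Qed.

(** Such elements, with 0 adjoined, form a submonoid containing [A]: in a sum, the generator is
    split off the first nonzero summand. *)
Lemma gen_decomp (A : set nat) (x : nat) : gen A x -> x <> 0%N ->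
  exists y r : nat, [/\ A y, y <> 0%N, gen A r & x = (y + r)%N].
Proof.
have [A0 AD] := gen_submonoid A.
(* Membership in [gen A] is carried along so that the new remainder [r + z] of a sum lies in
   [gen A]. *)
pose D x := gen A x /\ (x <> 0%N -> exists y r : nat,
  [/\ A y, y <> 0%N, gen A r & x = (y + r)%N]).
suff sub : gen A `<=` D by move=> /sub[].
apply: gen_min => [|y Ay]; first split=> [|y z [Ay Dy] [Az Dz]].
- by split.
- split; first exact: AD.
  case: (eqVneq y 0%N) => [->|/eqP/Dy [u [r [Au u0 Ar ->]]] _]; first exact: Dz.
  by exists u, (r + z)%N; split; rewrite ?addnA //; exact: AD.
- split; first exact: sub_gen.
  by move=> y0; exists y, 0%N; rewrite addn0; split.
Qed.

Section SequenceGenerators.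
Variable u : nat -> nat.

Lemma gen_prefix_le (k l : nat) :
  (k <= l)%N -> gen (u @` `I_k) `<=` gen (u @` `I_l).
Proof.
move=> kl; apply: gen_min; first exact: gen_submonoid.
move=> _ [i /= ik <-]; apply: sub_gen; exists i => //=.
exact: leq_trans ik kl.
Qed.

(** Summands never exceed their sum, so every generator used for [x] is below [u k] and, by
    monotonicity, has index below [k]. *)
Lemma gen_prefix_lt (k x : nat) (A : set nat) :
  {mono u : i j / (i < j)%N} -> A `<=` range u ->
  gen A x -> (x < u k)%N -> gen (u @` `I_k) x.
Proof.
move=> u_mono uA; have [G0 GD] := gen_submonoid (u @` `I_k).
move: x; apply: gen_min => [|_ /uA [i _ <-] uik]; last first.
  by apply: sub_gen; exists i => //=; rewrite -u_mono.
split=> [//|x y IHx IHy xyk].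
by apply: GD; [apply: IHx | apply: IHy]; apply: leq_ltn_trans xyk;
  rewrite ?leq_addr ?leq_addl.
Qed.

End SequenceGenerators.

Section ShiftedPowers.
Variables (a c d : int) (n : nat).
Hypotheses (a_ge2 : 2 <= a) (c_gt0 : 0 < c) (d_lt : d < c * a) (n_gt0 : (1 <= n)%N).
Local Notation s := (s a c d n).

Let sZ (j : nat) : (s j)%:Z = c * a ^+ (n + j) - d.
Proof. exact: sE. Qed.

Lemma s_gt0 (j : nat) : (0 < s j)%N.
Proof.
rewrite -ltz_nat sZ subr_gt0; apply: (lt_le_trans d_lt).
by rewrite ler_pM2l // -[leLHS]expr1 ler_weXn2l ?(leq_trans n_gt0) ?leq_addr //; lia.
Qed.

Lemma s_mono : {mono s : i j / (i < j)%N}.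
Proof.
apply: leqW_mono; apply: leq_mono => i j ij.
by rewrite -ltz_nat !sZ ltrD2r ltr_pM2l // ltr_eXn2l ?ltn_add2l.
Qed.

Lemma s_succ_add (i k r : nat) : s k = (s i + r)%N ->
  s k.+1 = (s i.+1 + absz a * r)%N.
Proof.
move=> /(congr1 Posz); rewrite PoszD !sZ => e.
apply/eqP; rewrite -eqz_nat PoszD PoszM !sZ gez0_abs; last by lia.
have -> : r%:Z = c * a ^+ (n + k) - c * a ^+ (n + i) by lia.
by rewrite !addnS !exprS; apply/eqP; ring.
Qed.

(** Only one generator [s i] is split off and shifted to [s i.+1]; the rest is scaled by [a], hence
    stays generated by the first [k] terms. *)
Lemma gen_prefix_succ (k : nat) :
  gen (s @` `I_k) (s k) -> gen (s @` `I_k.+1) (s k.+1).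
Proof.
move=> /gen_decomp []; first by have := s_gt0 k; lia.
move=> _ [r [[i /= ik <-] _ kr /s_succ_add ->]].
have [_ GD] := gen_submonoid (s @` `I_k.+1).
apply: GD; first by apply: sub_gen; exists i.+1.
by apply: gen_mull; apply: gen_prefix_le kr.
Qed.

Lemma gen_prefix_mono (k l : nat) : (k <= l)%N ->
  gen (s @` `I_k) (s k) -> gen (s @` `I_l) (s l).
Proof.
move=> /subnK <- kk; elim: (l - k)%N => // i IH.
exact: gen_prefix_succ.
Qed.

Lemma smonoid_prefix (m : nat) :
  gen (s @` `I_m) (s m) -> gen (s @` `I_m) = smonoid a c d n.
Proof.
move=> mm; apply/seteqP; split; apply: gen_min; try exact: gen_submonoid.
  by move=> _ [i _ <-]; apply: sub_gen; exists i.
move=> _ [j _ <-]; case: (ltnP j m) => [jm|]; first by apply: sub_gen; exists j.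
elim/ltn_ind: j => j IH mj.
(* The relation at [m] propagates to [j]; the predecessors of [s j] lie in the span of the first [m]
   terms, directly or by induction. *)
have := gen_prefix_mono _ _ mj mm; apply: gen_min; first exact: gen_submonoid.
move=> _ [i /= ij <-]; case: (ltnP i m) => [im|]; last exact: IH.
by apply: sub_gen; exists i.
Qed.

Lemma prefix_min (m : nat) (B : set nat) :
  ~ gen (s @` `I_m.-1) (s m.-1) -> gen B = smonoid a c d n ->
  s @` `I_m `<=` B.
Proof.
move=> nm gB _ [j /= jm <-].
have Bj : gen B (s j) by rewrite gB; apply: sub_gen; exists j.
have [|y [r [By y0 Br sj]]] := gen_decomp _ _ Bj; first by have := s_gt0 j; lia.
case: (posnP r) => [r0|r_gt0]; first by rewrite sj r0 addn0.
(* Now [y] and [r] are both positive, hence below [s j] and generated by its predecessors. The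
   resulting relation at [j <= m.-1] would propagate to [m.-1]. *)
case: nm; apply: (gen_prefix_mono j); first by lia.
have [_ GD] := gen_submonoid (s @` `I_j).
rewrite sj; apply: GD.
- apply: (gen_prefix_lt _ _ _ (range s) s_mono) => //; last by lia.
  by rewrite -/(smonoid a c d n) -gB; exact: sub_gen.
- apply: (gen_prefix_lt _ _ _ (range s) s_mono) => //; last by lia.
  by rewrite -/(smonoid a c d n) -gB.
Qed.

End ShiftedPowers.

Theorem theorem3p2 (a c d : int) (n m : nat)
    (ha : 2 <= a) (hc : 0 < c) (hd : d < c * a)
    (hda : gcdz d a = 1) (hdc : gcdz d c = 1)
    (hn : (1 <= n)%N) (hm : (0 < m)%N)
    (hmem : gen [set s a c d n j | j in `I_m] (s a c d n m))
    (hnmem : ~ gen [set s a c d n j | j in `I_(m - 1)] (s a c d n (m - 1)%N)) :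
  is_min_gen_set [set s a c d n j | j in `I_m] (smonoid a c d n) /\
  m = embdim (smonoid a c d n).
Proof.
have s_min : is_min_gen_set [set s a c d n j | j in `I_m] (smonoid a c d n).
  split; first exact: smonoid_prefix.
  by move=> B; apply: prefix_min => //; rewrite -subn1.
split=> //; rewrite /embdim.
have -> : min_gen_set (smonoid a c d n) = [set s a c d n j | j in `I_m].
  (* Existence and uniqueness rule out the default value of [xget]. *)
  by apply: xget_unique => // B B_min; exact: is_min_gen_set_uniq B_min s_min.
(* The image of [I_m] has [m] elements because [s] is strictly increasing, hence injective. *)
apply/esym/card_fset_set/inj_card_eq => i j _ _ sij.
have smono := s_mono _ _ _ _ ha hc hd hn.
by case: (ltngtP i j) => //; rewrite -smono sij ltnn.
Qed.
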